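(* Let $q$ be a prime power and let $L,M\in\mathbb{F}_q^{m\times k}$ be two $m\times k$ linear systems. Then $L$ and $M$ are isomorphic if and only if $t_L(f)=t_M(f)$ for all positive integers $n$ and all non-negative functions $f:\mathbb{F}_q^n\rightarrow\mathbb{R}_{\geq 0}$.
   Context: An $m\times k$ linear system is a matrix $L\in\mathbb{F}_q^{m\times k}$ with linearly independent rows, identified with the system of equations $\sum_{j=1}^k L_{ij}x_j=0$, $i\in[m]$. For $G=\mathbb{F}_q^n$, $\mathrm{Sol}(L)=\{(x_1,\dots,x_k)\in G^k: \sum_{j}L_{ij}x_j=0 \text{ for all } i\in[m]\}$. For functions $f_1,\dots,f_k:G\to\mathbb{C}$, $t_L(f_1,\dots,f_k)=\frac{1}{|\mathrm{Sol}(L)|}\sum_{(x_1,\dots,x_k)\in\mathrm{Sol}(L)}f_1(x_1)\cdots f_k(x_k)$, and $t_L(f)=t_L(f,\dots,f)$. Two $m\times k$ linear systems $L$ and $M$ are isomorphic if $M$ can be obtained from $L$ by applying row operations and column permutations (equivalently, $\mathrm{Sol}(M)$ is obtained from $\mathrm{Sol}(L)$ by permuting the indices of the variables). *)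

(* Defs.v *)
From HB Require Import structures.
From mathcomp Require Import all_boot all_order all_algebra all_fingroup.
From mathcomp Require Import reals.

Set Implicit Arguments.
Unset Strict Implicit.
Unset Printing Implicit Defensive.

Import Order.TTheory GRing.Theory Num.Theory.
Local Open Scope ring_scope.

Definition is_linear_system (F : finFieldType) (m k : nat)
  (L : 'M[F]_(m, k)) : bool := row_free L.

(* Sol(L) in G^k for G = F^n; row vectors 'rV[F]_n model F^n. *)
Definition sol (F : finFieldType) (m k : nat) (L : 'M[F]_(m, k)) (n : nat) :
    {set {ffun 'I_k -> 'rV[F]_n}} :=
  [set x : {ffun 'I_k -> 'rV[F]_n} |
    [forall i : 'I_m, \sum_(j < k) L i j *: x j == 0]].

(* The codomain is any numFieldType, so that the same definition serves for
   complex-valued functions and for real-valued ones. *)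
Definition t_multi (C : numFieldType) (F : finFieldType) (m k : nat)
    (L : 'M[F]_(m, k)) (n : nat) (f : 'I_k -> 'rV[F]_n -> C) : C :=
  (#|sol L n|%:R)^-1 * \sum_(x in sol L n) \prod_(j < k) f j (x j).

Definition t_single (C : numFieldType) (F : finFieldType) (m k : nat)
    (L : 'M[F]_(m, k)) (n : nat) (f : 'rV[F]_n -> C) : C :=
  t_multi L (fun _ : 'I_k => f).

(* Sequences of row operations amount to left multiplication by an invertible
   matrix P. Row operations and column permutations commute, so one of each
   suffices. *)
Definition isomorphic (F : finFieldType) (m k : nat) (L M : 'M[F]_(m, k)) :
    Prop :=
  exists (P : 'M[F]_m) (s : 'S_k), P \in unitmx /\ M = P *m col_perm s L.

(* Main.v *)
Require Import Defs.
From HB Require Import structures.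
From mathcomp Require Import all_boot all_order all_algebra all_fingroup.
From mathcomp Require Import reals.

(** Up to a positive factor, [t_L f] is a polynomial in the values of [f] whose
    monomials are the multisets of coordinates of the solutions of [L].  Take a
    solution [x] of [L] over [F^k] whose coordinates, as the rows of a matrix,
    have a column space equal to the whole kernel of [L].  If [t_L = t_M], the
    monomial of [x] also occurs in [t_M], so a permutation of [x] solves [M].
    Hence the kernel of [M] contains a permuted copy of the kernel of [L], and
    the two coincide since the dimensions agree.  To compare coefficients with
    univariate polynomials only, the [i]-th point of [F^k] is given the weight
    [t ^ ((k + 1) ^ i)] (Kronecker substitution). *)

Set Implicit Arguments.
Unset Strict Implicit.
Unset Printing Implicit Defensive.

Import Order.TTheory GRing.Theory Num.Theory.
Local Open Scope ring_scope.

Lemma base_expansion_inj (B n : nat) (a b : 'I_n -> nat) :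
    (forall i, a i < B)%N -> (forall i, b i < B)%N ->
    (\sum_(i < n) a i * B ^ i = \sum_(i < n) b i * B ^ i)%N -> a =1 b.
Proof.
elim: n a b => [|n IHn] a b ltaB ltbB; first by move=> _ [].
have split_low (c : 'I_n.+1 -> nat) : (\sum_(i < n.+1) c i * B ^ i
    = (\sum_(i < n) c (lift ord0 i) * B ^ i) * B + c ord0)%N.
  rewrite big_ord_recl expn0 muln1 addnC big_distrl /=; congr (_ + _)%N.
  by apply: eq_bigr => i _; rewrite -mulnA -expnSr.
rewrite !split_low => eq_ab.
have B_gt0 : (0 < B)%N by apply: leq_ltn_trans (ltaB ord0).
have eq0 : a ord0 = b ord0.
  have := congr1 (modn^~ B) eq_ab.
  by rewrite /= !modnMDl !modn_small.
have eqS : (fun i => a (lift ord0 i)) =1 (fun i => b (lift ord0 i)).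
  apply: IHn => //; move: eq_ab; rewrite eq0 => /addIn/eqP.
  by rewrite eqn_pmul2r // => /eqP.
by move=> i; case: (unliftP ord0 i) => [j|] ->; [exact: eqS | exact: eq0].
Qed.

(** In characteristic zero the naturals are distinct points, so [p - q] would have more roots than
    its degree allows. *)
Lemma poly_eq_on_nat (R : numDomainType) (p q : {poly R}) :
  (forall n : nat, p.[n%:R] = q.[n%:R]) -> p = q.
Proof.
move=> eq_pq; apply/eqP; rewrite -subr_eq0; apply/eqP.
pose rs : seq R := [seq n%:R | n <- iota 0 (size (p - q)%R)].
apply: (@roots_geq_poly_eq0 _ _ rs); last by rewrite size_map size_iota.
  by apply/allP => _ /mapP[n _ ->]; rewrite rootE !hornerE eq_pq subrr.
by rewrite map_inj_uniq ?iota_uniq // => i j /eqP; rewrite eqr_nat => /eqP.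
Qed.

Lemma ffun_permP (k : nat) (T : finType) (x y : {ffun 'I_k -> T}) :
    (forall v, #|[pred j | x j == v]| = #|[pred j | y j == v]|) ->
  exists s : 'S_k, forall j, y j = x (s j).
Proof.
move=> eq_card.
have /tuple_permP[s eq_s] : perm_eq [tuple y j | j < k] [tuple x j | j < k].
  apply/seq.permP => p.
  (* Grouping indices by value expresses every count through multiplicities. *)
  have countE (z : {ffun 'I_k -> T}) : count p [tuple z j | j < k]
      = (\sum_(v | p v) #|[pred j | z j == v]|)%N.
    rewrite /= count_map -sum1_count big_enum_cond /=.
    rewrite (partition_big z p) //=; apply: eq_bigr => v pv.
    rewrite -sum1_card; apply: eq_bigl => j; rewrite !inE.
    by case: eqP => [->|]; rewrite ?pv ?andbF.
  by rewrite !countE; apply: eq_bigr => v _; rewrite eq_card.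
exists s => j.
have /(congr1 (fun t => tnth t j)) :
    [tuple y j | j < k] = [tuple tnth [tuple x j | j < k] (s i) | i < k].
  exact: val_inj.
by rewrite !tnth_mktuple.
Qed.

(** In the application [a] and [b] are the inverse sizes of the two solution sets. All monomials
    enter with coefficient 1, so none can cancel within a sum. *)
Lemma monomial_support_perm (R : numDomainType) (k : nat) (T : finType)
    (A B : {set {ffun 'I_k -> T}}) (a b : R) (x : {ffun 'I_k -> T}) :
    a != 0 ->
    (forall f : T -> R, (forall v, 0 <= f v) ->
       a * (\sum_(z in A) \prod_(j < k) f (z j))
       = b * (\sum_(z in B) \prod_(j < k) f (z j))) ->
    x \in A ->
  exists (y : {ffun 'I_k -> T}) (s : 'S_k),
    y \in B /\ forall j, y j = x (s j).
Proof.
move=> a_neq0 eq_f xA.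
pose e (z : {ffun 'I_k -> T}) := (\sum_(j < k) k.+1 ^ enum_rank (z j))%N.
pose p (S : {set {ffun 'I_k -> T}}) : {poly R} := \sum_(z in S) 'X^(e z).
have coef_p S n : (p S)`_n = #|[set z in S | e z == n]|%:R.
  rewrite /p coef_sum -sum1_card natr_sum big_mkcond [RHS]big_mkcond /=.
  apply: eq_bigr => z _; rewrite coefXn inE eq_sym.
  by case: (z \in S) => //=; case: eqP.
have horner_p S (t : R) :
    (p S).[t] = \sum_(z in S) \prod_(j < k) t ^+ (k.+1 ^ enum_rank (z j)).
  rewrite /p horner_sum; apply: eq_bigr => z _.
  by rewrite hornerXn /e (big_morph (GRing.exp t) (@exprD _ t) (expr0 t)).
(* Evaluating at naturals only keeps the weights nonnegative, as [eq_f] requires. *)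
have eq_p : a *: p A = b *: p B.
  apply: poly_eq_on_nat => n; rewrite !hornerZ !horner_p.
  apply: (eq_f (fun v => n%:R ^+ (k.+1 ^ enum_rank v))) => v.
  by rewrite exprn_ge0 ?ler0n.
(* Otherwise the coefficient at [e x] vanishes on the right, while on the left it is [a] times a
   count that includes [x]. *)
have /set0Pn[y] : [set z in B | e z == e x] != set0.
  apply/eqP => B0; have := congr1 (fun r : {poly R} => r`_(e x)) eq_p.
  rewrite !coefZ !coef_p B0 cards0 mulr0 => /eqP; rewrite mulf_eq0.
  rewrite (negbTE a_neq0) pnatr_eq0 /= cards_eq0 => /eqP/setP/(_ x).
  by rewrite !inE xA eqxx.
rewrite inE => /andP[yB /eqP eq_e].
(* The multiplicities of the values of [z] are the digits of [e z]; being at most [k], they are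
   valid in base [k.+1]. *)
have eE z : e z
    = (\sum_(i < #|T|) #|[pred j | z j == enum_val i]| * k.+1 ^ i)%N.
  rewrite /e (partition_big (fun j => enum_rank (z j)) predT) //=.
  apply: eq_bigr => i _; rewrite -sum_nat_const.
  by apply: eq_big => [j|j /eqP-> //]; rewrite inE (can2_eq enum_rankK enum_valK).
have card_lt (z : {ffun 'I_k -> T}) i :
    (#|[pred j | z j == enum_val i]| < k.+1)%N.
  by rewrite ltnS -[leqRHS]card_ord max_card.
have [s eq_s] : exists s : 'S_k, forall j, y j = x (s j).
  apply: ffun_permP => v; rewrite -[v]enum_rankK.
  apply: (@base_expansion_inj k.+1 _ (fun i => #|[pred j | x j == enum_val i]|)
    (fun i => #|[pred j | y j == enum_val i]|)) => //.
  by rewrite -!eE eq_e.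
by exists y, s.
Qed.

Lemma mem_sol (F : finFieldType) (m k n : nat) (L : 'M[F]_(m, k))
    (x : {ffun 'I_k -> 'rV[F]_n}) :
  (x \in sol L n) = (L *m (\matrix_(j < k) x j) == 0).
Proof.
have rowE i : row i (L *m (\matrix_(j < k) x j)) = \sum_(j < k) L i j *: x j.
  by rewrite row_mul mulmx_sum_row; apply: eq_bigr => j _; rewrite mxE rowK.
rewrite inE; apply/forallP/eqP => [solx|Lx0 i].
  by apply/row_matrixP => i; rewrite rowE row0; apply/eqP.
by rewrite -rowE Lx0 row0.
Qed.

(** Permuting the columns of [L] and the coordinates of [x] alike preserves the product, and an
    invertible [P] preserves its vanishing. *)
Lemma sol_isomorphic (F : finFieldType) (m k n : nat) (L : 'M[F]_(m, k))
    (P : 'M[F]_m) (s : 'S_k) : P \in unitmx ->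
  sol (P *m col_perm s L) n
  = [set [ffun j => x (s j)] | x : {ffun 'I_k -> 'rV[F]_n} in sol L n].
Proof.
move=> unitP.
have mem_perm (x : {ffun 'I_k -> 'rV[F]_n}) :
    ([ffun j => x (s j)] \in sol (P *m col_perm s L) n) = (x \in sol L n).
  rewrite !mem_sol -mulmxA.
  have -> : \matrix_j [ffun j => x (s j)] j = row_perm s (\matrix_j x j).
    by apply/matrixP => i j; rewrite !mxE ffunE.
  rewrite row_permE col_permE -(mulmxA L) (mulmxA (perm_mx _)) -perm_mxM.
  rewrite mulVg perm_mx1 mul1mx.
  apply/eqP/eqP => [PLx0|->]; last by rewrite mulmx0.
  by rewrite -(mulKmx unitP (L *m _)) PLx0 mulmx0.
apply/setP => y; apply/idP/imsetP => [yM|[x xL ->]]; last by rewrite mem_perm.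
have yE : y = [ffun j => [ffun i => y ((s^-1)%g i)] (s j)].
  by apply/ffunP => j; rewrite !ffunE permK.
by exists [ffun i => y ((s^-1)%g i)] => //; rewrite -mem_perm -yE.
Qed.

Lemma t_single_isomorphic (C : numFieldType) (F : finFieldType) (m k n : nat)
    (L M : 'M[F]_(m, k)) (f : 'rV[F]_n -> C) :
  isomorphic L M -> t_single L f = t_single M f.
Proof.
move=> [P [s [unitP ->]]]; rewrite /t_single /t_multi sol_isomorphic //.
have inj_s : injective
    (fun x : {ffun 'I_k -> 'rV[F]_n} => [ffun j => x (s j)]).
  move=> x y /ffunP eq_xy; apply/ffunP => j.
  by have := eq_xy ((s^-1)%g j); rewrite !ffunE permKV.
rewrite card_imset // big_imset /=; last by move=> x y _ _ /inj_s.
congr (_ * _); apply: eq_bigr => x _.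
by rewrite (reindex_inj (@perm_inj _ s)); apply: eq_bigr => j _; rewrite ffunE.
Qed.

Lemma card_sol_neq0 (C : numFieldType) (F : finFieldType) (m k n : nat)
    (L : 'M[F]_(m, k)) : (#|sol L n|%:R : C) != 0.
Proof.
rewrite pnatr_eq0 cards_eq0; apply/set0Pn; exists [ffun=> 0].
rewrite inE; apply/forallP => i.
by rewrite big1 // => j _; rewrite ffunE scaler0.
Qed.

(** The hypothesis puts the rows of [M], after a column permutation, in the row space of [L], so
    [M = D *m col_perm s L] for some square [D]. Since [M] has rank [m], so does [D]. *)
Lemma isomorphic_of_cokermx (F : finFieldType) (m k : nat)
    (L M : 'M[F]_(m, k)) (s : 'S_k) :
  row_free M -> M *m row_perm s (cokermx L) = 0 -> isomorphic L M.
Proof.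
move=> freeM; rewrite row_permE mulmxA => /eqP; rewrite -submxE.
case/submxP => D MsE.
have ME : M = D *m col_perm s L.
  by rewrite col_permE mulmxA -MsE -mulmxA -perm_mxM mulgV perm_mx1 mulmx1.
exists D, s; split => //.
rewrite -row_free_unit /row_free eqn_leq rank_leq_row -{1}(eqP freeM) ME.
exact: mxrankM_maxl.
Qed.

Theorem theorem4p1 (R : realType) (F : finFieldType) (m k : nat)
    (L M : 'M[F]_(m, k))
    (hL : is_linear_system L) (hM : is_linear_system M) :
  isomorphic L M <->
  (forall (n : nat) (f : 'rV[F]_n -> R),
     (0 < n)%N -> (forall x, 0 <= f x) -> t_single L f = t_single M f).
Proof.
split=> [isoLM n f _ _|eq_t]; first exact: t_single_isomorphic.
(* The test solution lives in dimension [n = k], which must be positive; for [k = 0] both matrices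
   are empty. *)
have [k0|k_gt0] := posnP k.
  exists 1%:M, 1%g; split; first exact: unitmx1.
  by subst k; rewrite [LHS]thinmx0 [RHS]thinmx0.
(* The columns of the [k] by [k] matrix [cokermx L] span the kernel of [L]. *)
pose x := [ffun j => row j (cokermx L)].
have xL : x \in sol L k.
  rewrite mem_sol; apply/eqP; rewrite -[RHS](mulmx_coker L); congr (_ *m _).
  by apply/row_matrixP => j; rewrite rowK ffunE.
have [y [s [yM yE]]] := monomial_support_perm
  (invr_neq0 (card_sol_neq0 R k L)) (fun f => eq_t k f k_gt0) xL.
apply: (@isomorphic_of_cokermx _ _ _ _ _ s) => //.
move: yM; rewrite mem_sol => /eqP yM; rewrite -[RHS]yM; congr (_ *m _).
by apply/matrixP => i j; rewrite !mxE yE ffunE !mxE.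
Qed.
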